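(* Let $(A,\mu,\partial)$ be a multivariable GDQ ring with gradient $\partial=(\partial_1,\dots,\partial_n)$ and associated cyclic gradient $\mathcal{D}=(\mathcal{D}_1,\dots,\mathcal{D}_n)$. Suppose that: (a) there exists a divergence $\partial^\star=(\partial^\star_1,\dots,\partial^\star_n)$ for $(A,\mu,\partial)$ such that each $\partial_i^\star: A\otimes A\to A$ is an $A$-bimodule homomorphism; put $N:=\sum_{i=1}^n\partial_i^\star\circ\partial_i$ and $L:=N+\mathrm{id}_A$; (b) there exists a cyclic divergence $\mathcal{D}^\star=(\mathcal{D}_1^\star,\dots,\mathcal{D}_n^\star)$ compatible with $\partial^\star$; (c) $L: A\to A$ is injective, and the ranges of $\mathcal{D}^\star: A^n\to A$ and $N: A\to A$ satisfy $\operatorname{ran}\mathcal{D}^\star\subseteq\operatorname{ran}N$. Then, for any $a=(a_1,\dots,a_n)\in A^n$, the following statements are equivalent: (i) $a$ is a cyclic gradient, i.e., there exists $b\in A$ such that $\mathcal{D}b=a$. (ii) $a$ is cyclically irrotational. (iii) $\mathcal{D}_j(\mathcal{D}^\star a)=La_j$ for $j=1,\dots,n$.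
   Context: Algebras are associative complex algebras (not necessarily unital); tensor products are algebraic over $\mathbb{C}$. $A\otimes A$ is an $A$-bimodule via $b_1\cdot(a_1\otimes a_2)\cdot b_2=(b_1a_1)\otimes(a_2b_2)$. A multivariable GDQ (generalized difference quotient) ring is a triple $(A,\mu,\partial)$ of a complex algebra $A$, its multiplication map $\mu:A\otimes A\to A$, $\mu(a_1\otimes a_2)=a_1a_2$, and an $n$-tuple $\partial=(\partial_1,\dots,\partial_n)$ of linear maps $\partial_i:A\to A\otimes A$ such that $(\partial_i\otimes\mathrm{id}_A)\circ\partial_j=(\mathrm{id}_A\otimes\partial_j)\circ\partial_i$ for all $i,j$, and each $\partial_i$ is a derivation: $\partial_i(a_1a_2)=(\partial_ia_1)\cdot a_2+a_1\cdot(\partial_ia_2)$. Let $\sigma(a_1\otimes a_2)=a_2\otimes a_1$ be the flip on $A\otimes A$. The cyclic derivatives are $\mathcal{D}_i:=\mu\circ\sigma\circ\partial_i:A\to A$, and the cyclic gradient is $\mathcal{D}=(\mathcal{D}_1,\dots,\mathcal{D}_n):A\to A^n$. A divergence for $(A,\mu,\partial)$ is an $n$-tuple $\partial^\star=(\partial_1^\star,\dots,\partial_n^\star)$ of linear maps $\partial_i^\star:A\otimes A\to A$ with $\partial_j\circ\partial_i^\star=(\partial_i^\star\otimes\mathrm{id}_A)\circ(\mathrm{id}_A\otimes\partial_j)+(\mathrm{id}_A\otimes\partial_i^\star)\circ(\partial_j\otimes\mathrm{id}_A)+\delta_{i,j}\mathrm{id}_{A\otimes A}$ for all $i,j$. A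 cyclic divergence compatible with $\partial^\star$ is an $n$-tuple $\mathcal{D}^\star=(\mathcal{D}_1^\star,\dots,\mathcal{D}_n^\star)$ of linear maps $\mathcal{D}_i^\star:A\to A$ with $\mathcal{D}_j\circ\mathcal{D}_i^\star=\partial_i^\star\circ\sigma\circ\partial_j+\delta_{i,j}\mathrm{id}_A$ for all $i,j$; it is viewed as the linear map $\mathcal{D}^\star:A^n\to A$, $\mathcal{D}^\star(a)=\sum_{i=1}^n\mathcal{D}_i^\star(a_i)$. A tuple $a\in A^n$ is cyclically irrotational if $\partial_ia_j=\sigma(\partial_ja_i)$ for all $i,j=1,\dots,n$. *)

(* Defs.v *)
(* The field of complex numbers is R[i] for R : realType. *)
From HB Require Import structures.
From mathcomp Require Import all_boot all_order all_algebra.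
From mathcomp Require Import boolp classical_sets reals complex.
From mathcomp Require Import finmap monalg.

Set Implicit Arguments.
Unset Strict Implicit.
Unset Printing Implicit Defensive.

Import GRing.Theory.
Local Open Scope ring_scope.
Local Open Scope quotient_scope.

Fact bilinearI (K : nzRingType) (U V W : lmodType K) (f : U -> V -> W) :
  (forall v k u u', f (k *: u + u') v = k *: f u v + f u' v) ->
  (forall u k v v', f u (k *: v + v') = k *: f u v + f u v') ->
  bilinear_for *:%R *:%R f.
Proof. by move=> fl fr; split=> [v k u u'|u k v v'] /=; rewrite (fl, fr). Qed.

Section TensorProduct.
Variables (K : comNzRingType) (U V : lmodType K).

(* The submodule of the free module on U * V spanned by the bilinearity
   relations; the tensor product is the quotient by it. *)
Inductive tensor_null : {malg K[(U * V)%type]} -> Prop :=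
| Tensor_null0 : tensor_null 0
| Tensor_nullD x y : tensor_null x -> tensor_null y -> tensor_null (x + y)
| Tensor_nullZ k x : tensor_null x -> tensor_null (k *: x)
| Tensor_nullDl u u' v :
    tensor_null (<< (u + u', v) >> - (<< (u, v) >> + << (u', v) >>))
| Tensor_nullDr u v v' :
    tensor_null (<< (u, v + v') >> - (<< (u, v) >> + << (u, v') >>))
| Tensor_nullZl k u v : tensor_null (<< (k *: u, v) >> - k *: << (u, v) >>)
| Tensor_nullZr k u v : tensor_null (<< (u, k *: v) >> - k *: << (u, v) >>).

Definition tensor_nullb : {pred {malg K[(U * V)%type]}} :=
  fun x => `[< tensor_null x >].

Fact tensor_nullb_zmod_closed : zmod_closed tensor_nullb.
Proof.
split; first by apply/asboolP; exact: Tensor_null0.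
move=> x y /asboolP hx /asboolP hy; apply/asboolP.
by apply: Tensor_nullD => //; rewrite -scaleN1r; exact: Tensor_nullZ.
Qed.

HB.instance Definition _ :=
  GRing.isZmodClosed.Build {malg K[(U * V)%type]} tensor_nullb
    tensor_nullb_zmod_closed.

Definition tensor : Type := Quotient.quot tensor_nullb.

HB.instance Definition _ := Choice.on tensor.
HB.instance Definition _ := GRing.Zmodule.on tensor.

Definition tensor_pi (x : {malg K[(U * V)%type]}) : tensor :=
  \pi_(Quotient.quot tensor_nullb) x.

Definition tensor_repr (t : tensor) : {malg K[(U * V)%type]} :=
  repr (t : Quotient.quot tensor_nullb).

Lemma tensor_reprK : cancel tensor_repr tensor_pi.
Proof. by move=> t; exact: reprK. Qed.

Fact tensor_pi_zmod_morphism : zmod_morphism tensor_pi.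
Proof. by move=> x y; exact: raddfB. Qed.

HB.instance Definition _ := GRing.isZmodMorphism.Build _ _ tensor_pi
  tensor_pi_zmod_morphism.

Lemma tensor_piP x y : tensor_pi x = tensor_pi y <-> tensor_null (x - y).
Proof.
split=> [/eqP|h].
  by rewrite /tensor_pi -Quotient.idealrBE => /asboolP.
by apply/eqP; rewrite /tensor_pi -Quotient.idealrBE; apply/asboolP.
Qed.

Definition tensor_scale (k : K) (t : tensor) : tensor :=
  tensor_pi (k *: tensor_repr t).

Lemma tensor_scale_pi k x : tensor_scale k (tensor_pi x) = tensor_pi (k *: x).
Proof.
apply/tensor_piP; rewrite -scalerBr; apply: Tensor_nullZ.
by apply/tensor_piP; rewrite tensor_reprK.
Qed.

Fact tensor_scaleA a b t :
  tensor_scale a (tensor_scale b t) = tensor_scale (a * b) t.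
Proof. by rewrite -[t]tensor_reprK !tensor_scale_pi scalerA. Qed.

Fact tensor_scale1 : left_id 1 tensor_scale.
Proof. by move=> t; rewrite -[t]tensor_reprK tensor_scale_pi scale1r. Qed.

Fact tensor_scaleDr : right_distributive tensor_scale +%R.
Proof.
move=> k s t; rewrite -[s]tensor_reprK -[t]tensor_reprK -raddfD.
by rewrite !tensor_scale_pi scalerDr raddfD.
Qed.

Fact tensor_scaleDl t : {morph tensor_scale^~ t : a b / a + b}.
Proof.
by move=> a b; rewrite -[t]tensor_reprK !tensor_scale_pi scalerDl raddfD.
Qed.

HB.instance Definition _ := GRing.Zmodule_isLmodule.Build K tensor
  tensor_scaleA tensor_scale1 tensor_scaleDr tensor_scaleDl.

End TensorProduct.

HB.lock Definition tens (K : comNzRingType) (U V : lmodType K) (u : U) (v : V) :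
  tensor U V := tensor_pi << (u, v) >>.
Canonical tens_unlockable := Unlockable tens.unlock.

Section TensorElements.
Variables (K : comNzRingType) (U V : lmodType K).
Local Notation tensor := (tensor U V).
Local Notation tens := (@tens K U V).

Fact tensDl u u' v : tens (u + u') v = tens u v + tens u' v.
Proof. by rewrite !tens.unlock -raddfD; apply/tensor_piP; exact: Tensor_nullDl. Qed.

Fact tensDr u v v' : tens u (v + v') = tens u v + tens u v'.
Proof. by rewrite !tens.unlock -raddfD; apply/tensor_piP; exact: Tensor_nullDr. Qed.

Fact tensZl k u v : tens (k *: u) v = k *: tens u v.
Proof.
rewrite !tens.unlock [RHS]tensor_scale_pi.
by apply/tensor_piP; exact: Tensor_nullZl.
Qed.

Fact tensZr k u v : tens u (k *: v) = k *: tens u v.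
Proof.
rewrite !tens.unlock [RHS]tensor_scale_pi.
by apply/tensor_piP; exact: Tensor_nullZr.
Qed.

Fact tens_bilinear : bilinear_for *:%R *:%R tens.
Proof.
by apply: bilinearI => *; rewrite ?(tensDl, tensDr) ?(tensZl, tensZr).
Qed.

HB.instance Definition _ :=
  bilinear_isBilinear.Build K U V tensor *:%R *:%R tens tens_bilinear.

Lemma tensorP (P : tensor -> Prop) :
  P 0 -> (forall s t, P s -> P t -> P (s + t)) ->
  (forall u v, P (tens u v)) -> forall t, P t.
Proof.
move=> P0 PD Pt t; rewrite -[t]tensor_reprK [tensor_repr t]monalgE raddf_sum.
elim/big_ind: _ => //= -[u v] _; set k := mcoeff _ _.
suff -> : tensor_pi << k *g (u, v) >> = tens (k *: u) v by exact: Pt.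
rewrite tensZl tens.unlock [RHS]tensor_scale_pi; congr tensor_pi.
by apply/malgP => z; rewrite mcoeffZ !mcoeffU; case: eqP; rewrite ?mulr1 ?mulr0.
Qed.

End TensorElements.

Notation "U ⊗ V" := (tensor U V) (at level 40, left associativity).
Notation "x ⊗ₜ y" := (tens x y) (at level 40, left associativity).

Section FreeLift.
Variables (K : comNzRingType) (U V W : lmodType K).

Definition free_lift (f : U -> V -> W) (x : {malg K[(U * V)%type]}) : W :=
  \sum_(k <- msupp x) x@_k *: f k.1 k.2.

Lemma free_liftEw (f : U -> V -> W) (x : {malg K[(U * V)%type]})
    (E : {fset U * V}%fset) : (msupp x `<=` E)%fset ->
  free_lift f x = \sum_(k <- E) x@_k *: f k.1 k.2.
Proof.
move=> le; rewrite /free_lift [LHS](big_fset_incl _ le) //= => k kE.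
by move=> /mcoeff_outdom ->; rewrite scale0r.
Qed.

Fact free_lift_linear f : linear (free_lift f).
Proof.
move=> k x y; pose E := (msupp x `|` msupp y `|` msupp (k *: x + y))%fset.
have lx : (msupp x `<=` E)%fset.
  by rewrite /E -fsetUA fsubsetUl.
have ly : (msupp y `<=` E)%fset.
  by rewrite /E fsetUAC fsubsetUr.
have lz : (msupp (k *: x + y) `<=` E)%fset by rewrite /E fsubsetUr.
rewrite (free_liftEw _ lx) (free_liftEw _ ly) (free_liftEw _ lz).
rewrite scaler_sumr -big_split /=; apply: eq_bigr => z _.
by rewrite mcoeffD mcoeffZ scalerDl scalerA.
Qed.

HB.instance Definition _ f :=
  GRing.isLinear.Build K _ W *:%R (free_lift f) (free_lift_linear f).

Lemma free_liftU f u v : free_lift f << (u, v) >> = f u v.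
Proof.
rewrite (@free_liftEw _ _ [fset (u, v)]%fset) ?msuppU_le //.
by rewrite big_seq_fset1 mcoeffUU scale1r.
Qed.

Variable f : {bilinear U -> V -> W}.

Lemma free_lift_null x : tensor_null x -> free_lift f x = 0.
Proof.
elim=> {x} [|x y _ hx _ hy|k x _ hx|u u' v|u v v'|k u v|k u v].
- exact: raddf0.
- by rewrite raddfD /= hx hy addr0.
- by rewrite linearZ_LR /= hx scaler0.
- by rewrite raddfB raddfD /= !free_liftU linearDl subrr.
- by rewrite raddfB raddfD /= !free_liftU linearDr subrr.
- by rewrite raddfB /= linearZ_LR /= !free_liftU linearZl_LR subrr.
- by rewrite raddfB /= linearZ_LR /= !free_liftU linearZr_LR subrr.
Qed.

End FreeLift.

(* The linear map U ⊗ V -> W induced by f; see tensor_liftE. *)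
HB.lock Definition tensor_lift (K : comNzRingType) (U V W : lmodType K)
  (f : {bilinear U -> V -> W}) (t : U ⊗ V) : W := free_lift f (tensor_repr t).
Canonical tensor_lift_unlockable := Unlockable tensor_lift.unlock.

Section TensorLift.
Variables (K : comNzRingType) (U V W : lmodType K) (f : {bilinear U -> V -> W}).
Local Notation tensor_lift := (tensor_lift f).

Lemma tensor_lift_pi x : tensor_lift (tensor_pi x) = free_lift f x.
Proof.
apply/eqP; rewrite -subr_eq0 !tensor_lift.unlock -raddfB; apply/eqP.
by apply: free_lift_null; apply/tensor_piP; rewrite tensor_reprK.
Qed.

Fact tensor_lift_linear : linear tensor_lift.
Proof.
move=> k s t; rewrite -[s]tensor_reprK -[t]tensor_reprK.
rewrite [k *: _]tensor_scale_pi -raddfD !tensor_lift_pi.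
exact: free_lift_linear.
Qed.

HB.instance Definition _ :=
  GRing.isLinear.Build K _ W *:%R tensor_lift tensor_lift_linear.

Lemma tensor_liftE u v : tensor_lift (u ⊗ₜ v) = f u v.
Proof. by rewrite tens.unlock tensor_lift_pi free_liftU. Qed.

End TensorLift.

Lemma tensor_eq_lin (K : comNzRingType) (U V W : lmodType K)
    (f g : {linear U ⊗ V -> W}) :
  (forall u v, f (u ⊗ₜ v) = g (u ⊗ₜ v)) -> f =1 g.
Proof.
move=> fg; apply: tensorP => [|s t hs ht|//]; first by rewrite !linear0.
by rewrite !linearD /= hs ht.
Qed.

Section TensorMap.
Variables (K : comNzRingType) (U V U' V' : lmodType K).
Variables (f : {linear U -> U'}) (g : {linear V -> V'}).

Definition tensor_map_fun (u : U) (v : V) : U' ⊗ V' := f u ⊗ₜ g v.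

Fact tensor_map_fun_bilinear : bilinear_for *:%R *:%R tensor_map_fun.
Proof.
by apply: bilinearI => [v k u u'|u k v v'];
  rewrite /tensor_map_fun linearP ?linearPl ?linearPr.
Qed.

HB.instance Definition _ := bilinear_isBilinear.Build K U V (U' ⊗ V') *:%R *:%R
  tensor_map_fun tensor_map_fun_bilinear.

Definition tensor_map : U ⊗ V -> U' ⊗ V' := tensor_lift tensor_map_fun.

HB.instance Definition _ := GRing.Linear.on tensor_map.

Lemma tensor_mapE u v : tensor_map (u ⊗ₜ v) = f u ⊗ₜ g v.
Proof. exact: tensor_liftE. Qed.

End TensorMap.

Section TensorFlip.
Variables (K : comNzRingType) (U V : lmodType K).

Definition tensor_flip_fun (u : U) (v : V) : V ⊗ U := v ⊗ₜ u.

Fact tensor_flip_fun_bilinear : bilinear_for *:%R *:%R tensor_flip_fun.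
Proof.
by apply: bilinearI => *; rewrite /tensor_flip_fun ?linearPl ?linearPr.
Qed.

HB.instance Definition _ := bilinear_isBilinear.Build K U V (V ⊗ U) *:%R *:%R
  tensor_flip_fun tensor_flip_fun_bilinear.

Definition tensor_flip : U ⊗ V -> V ⊗ U := tensor_lift tensor_flip_fun.

HB.instance Definition _ := GRing.Linear.on tensor_flip.

Lemma tensor_flipE u v : tensor_flip (u ⊗ₜ v) = v ⊗ₜ u.
Proof. exact: tensor_liftE. Qed.

End TensorFlip.

(* The two triple tensor products are distinct types: they are identified
   through the mutually inverse isomorphisms tensor_assocr and tensor_assocl. *)
Section TensorAssoc.
Variables (K : comNzRingType) (U V W : lmodType K).

Definition tensl (w : W) : V -> V ⊗ W := fun v => v ⊗ₜ w.
Fact tensl_linear w : linear (tensl w).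
Proof. by move=> k v v'; rewrite /tensl linearPl. Qed.
HB.instance Definition _ w := GRing.isLinear.Build K V (V ⊗ W) *:%R
  (tensl w) (tensl_linear w).

Definition tensr (u : U) : V -> U ⊗ V := fun v => u ⊗ₜ v.
Fact tensr_linear u : linear (tensr u).
Proof. by move=> k v v'; rewrite /tensr linearPr. Qed.
HB.instance Definition _ u := GRing.isLinear.Build K V (U ⊗ V) *:%R
  (tensr u) (tensr_linear u).

Definition assocr_fun (t : U ⊗ V) (w : W) : U ⊗ (V ⊗ W) :=
  tensor_map idfun (tensl w) t.

Fact assocr_fun_bilinear : bilinear_for *:%R *:%R assocr_fun.
Proof.
apply: bilinearI => [w k s t|t k w w']; first exact: linearP.
rewrite /assocr_fun; elim/tensorP: t => [|s t hs ht|u v].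
- by rewrite !linear0 addr0.
- by rewrite !linearD /= hs ht addrACA.
- by rewrite !tensor_mapE /= /tensl !(tensDr, tensZr).
Qed.

HB.instance Definition _ := bilinear_isBilinear.Build K (U ⊗ V) W (U ⊗ (V ⊗ W))
  *:%R *:%R assocr_fun assocr_fun_bilinear.

Definition tensor_assocr : (U ⊗ V) ⊗ W -> U ⊗ (V ⊗ W) :=
  tensor_lift assocr_fun.

HB.instance Definition _ := GRing.Linear.on tensor_assocr.

Lemma tensor_assocrE u v w : tensor_assocr ((u ⊗ₜ v) ⊗ₜ w) = u ⊗ₜ (v ⊗ₜ w).
Proof. by rewrite /tensor_assocr tensor_liftE /= /assocr_fun tensor_mapE. Qed.

Definition assocl_fun (u : U) (t : V ⊗ W) : (U ⊗ V) ⊗ W :=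
  tensor_map (tensr u) idfun t.

Fact assocl_fun_bilinear : bilinear_for *:%R *:%R assocl_fun.
Proof.
apply: bilinearI => [t k u u'|u k s t]; last exact: linearP.
rewrite /assocl_fun; elim/tensorP: t => [|s t hs ht|v w].
- by rewrite !linear0 addr0.
- by rewrite !linearD /= hs ht addrACA.
- by rewrite !tensor_mapE /= /tensr !(tensDl, tensZl).
Qed.

HB.instance Definition _ := bilinear_isBilinear.Build K U (V ⊗ W) ((U ⊗ V) ⊗ W)
  *:%R *:%R assocl_fun assocl_fun_bilinear.

Definition tensor_assocl : U ⊗ (V ⊗ W) -> (U ⊗ V) ⊗ W :=
  tensor_lift assocl_fun.

HB.instance Definition _ := GRing.Linear.on tensor_assocl.

Lemma tensor_assoclE u v w : tensor_assocl (u ⊗ₜ (v ⊗ₜ w)) = (u ⊗ₜ v) ⊗ₜ w.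
Proof. by rewrite /tensor_assocl tensor_liftE /= /assocl_fun tensor_mapE. Qed.

Lemma tensor_assocrK : cancel tensor_assocr tensor_assocl.
Proof.
apply: tensorP => [|s t hs ht|s w]; first by rewrite !linear0.
  by rewrite !linearD /= hs ht.
elim/tensorP: s => [|s t hs ht|u v]; first by rewrite linear0l !linear0.
  by rewrite linearDl !linearD /= hs ht.
by rewrite tensor_assocrE tensor_assoclE.
Qed.

Lemma tensor_assoclK : cancel tensor_assocl tensor_assocr.
Proof.
apply: tensorP => [|s t hs ht|u s]; first by rewrite !linear0.
  by rewrite !linearD /= hs ht.
elim/tensorP: s => [|s t hs ht|v w]; first by rewrite linear0r !linear0.
  by rewrite linearDr !linearD /= hs ht.
by rewrite tensor_assoclE tensor_assocrE.
Qed.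

End TensorAssoc.

(* Associative, not necessarily unital, K-algebras. *)
HB.mixin Record Lmodule_isNuAlgebra (K : nzRingType) A
    of GRing.Lmodule K A := {
  nmul : {bilinear A -> A -> A};
  nmulA : associative nmul
}.

#[short(type="nuAlgType")]
HB.structure Definition NuAlgebra (K : nzRingType) :=
  { A of Lmodule_isNuAlgebra K A & GRing.Lmodule K A }.

Section GDQ.
Variables (K : comNzRingType) (A : nuAlgType K).

Definition mu : A ⊗ A -> A := tensor_lift (nmul : {bilinear A -> A -> A}).

HB.instance Definition _ := GRing.Linear.on mu.

Lemma muE x y : mu (x ⊗ₜ y) = nmul x y.
Proof. exact: tensor_liftE. Qed.

Definition lmul (b : A) : A -> A := fun a => nmul b a.
Definition rmul (b : A) : A -> A := fun a => nmul a b.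

Fact lmul_linear b : linear (lmul b).
Proof. by move=> k a a'; rewrite /lmul linearPr. Qed.
HB.instance Definition _ b := GRing.isLinear.Build K A A *:%R
  (lmul b) (lmul_linear b).

Fact rmul_linear b : linear (rmul b).
Proof. by move=> k a a'; rewrite /rmul linearPl. Qed.
HB.instance Definition _ b := GRing.isLinear.Build K A A *:%R
  (rmul b) (rmul_linear b).

Definition lact (b : A) (t : A ⊗ A) : A ⊗ A := tensor_map (lmul b) idfun t.
Definition ract (t : A ⊗ A) (b : A) : A ⊗ A := tensor_map idfun (rmul b) t.

Lemma lactE b x y : lact b (x ⊗ₜ y) = nmul b x ⊗ₜ y.
Proof. exact: tensor_mapE. Qed.

Lemma ractE x y b : ract (x ⊗ₜ y) b = x ⊗ₜ nmul y b.
Proof. exact: tensor_mapE. Qed.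

(* As A need not have a unit, compatibility with each one-sided action has to
   be required separately. *)
Definition bimodule_hom (f : A ⊗ A -> A) : Prop :=
  (forall b t, f (lact b t) = nmul b (f t)) /\
  (forall t b, f (ract t b) = nmul (f t) b).

Definition derivation (d : A -> A ⊗ A) : Prop :=
  forall a b, d (nmul a b) = ract (d a) b + lact a (d b).

Definition cyclic_derivative (d : A -> A ⊗ A) (a : A) : A :=
  mu (tensor_flip (d a)).

Variable n : nat.
Implicit Types (d : 'I_n -> {linear A -> A ⊗ A})
  (ds : 'I_n -> {linear A ⊗ A -> A}) (Ds : 'I_n -> {linear A -> A}).

Definition gdq_ring d : Prop :=
  (forall i j a, tensor_assocr (tensor_map (d i) idfun (d j a)) =
                 tensor_map idfun (d j) (d i a)) /\
  (forall i, derivation (d i)).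

Definition cyclic_gradient d (b : A) : {ffun 'I_n -> A} :=
  [ffun i => cyclic_derivative (d i) b].

Definition divergence d ds : Prop :=
  forall i j (t : A ⊗ A),
    d j (ds i t) =
      tensor_map (ds i) idfun (tensor_assocl (tensor_map idfun (d j) t)) +
      tensor_map idfun (ds i) (tensor_assocr (tensor_map (d j) idfun t)) +
      (i == j)%:R *: t.

Definition cyclic_divergence d ds Ds : Prop :=
  forall i j (a : A),
    cyclic_derivative (d j) (Ds i a) =
      ds i (tensor_flip (d j a)) + (i == j)%:R *: a.

Definition cyclic_div Ds (a : {ffun 'I_n -> A}) : A := \sum_i Ds i (a i).

Definition number_op d ds (a : A) : A := \sum_i ds i (d i a).

Definition number_op1 d ds (a : A) : A := number_op d ds a + a.

Definition cyclically_irrotational d (a : {ffun 'I_n -> A}) : Prop :=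
  forall i j, d i (a j) = tensor_flip (d j (a i)).

End GDQ.

(* Main.v *)
(* Set N = \sum_i ds_i d_i. The divergence relation and coassociativity give
   d_j N = (N ⊗ id + id ⊗ N + id) d_j, while N is a derivation because the
   ds_i are bimodule maps and the d_i are derivations; hence D_j N = (N + id) D_j
   on A. If D_j (D^* a) = (N + id) a_j and D^* a = N b, then
   (N + id) (D_j b) = (N + id) a_j, so D b = a by injectivity. That cyclic
   gradients are irrotational is coassociativity, since d_i (D_j b) is a sum of
   two contractions of elements of A ⊗ (A ⊗ A) that the flip exchanges. *)
Require Import Defs.
From HB Require Import structures.
From mathcomp Require Import all_boot all_order all_algebra.
From mathcomp Require Import boolp classical_sets reals complex.

Set Implicit Arguments.
Unset Strict Implicit.
Unset Printing Implicit Defensive.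

Import GRing.Theory.
Local Open Scope ring_scope.

Lemma tensor_flipK (K : comNzRingType) (U V : lmodType K) :
  cancel (@tensor_flip K U V) (@tensor_flip K V U).
Proof.
apply: tensorP => [|s t hs ht|u v]; first by rewrite !linear0.
  by rewrite !linearD /= hs ht.
by rewrite !tensor_flipE.
Qed.

Lemma sum_delta_scale (K : nzRingType) (V : lmodType K) (I : finType) (j : I)
    (v : I -> V) :
  \sum_i (i == j)%:R *: v i = v j.
Proof.
rewrite (bigD1 j) //= eqxx scale1r big1 ?addr0 // => i /negPf->.
by rewrite scale0r.
Qed.

Section CyclicContraction.
Variables (K : comNzRingType) (A : nuAlgType K).
Local Notation mu := (@mu K A).

(* [x ⊗ (u ⊗ v)] is sent to [u ⊗ v x]. *)
Definition contract_outer (s : A ⊗ (A ⊗ A)) : A ⊗ A :=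
  tensor_map idfun mu (tensor_assocr (tensor_flip s)).

Fact contract_outer_linear : linear contract_outer.
Proof. by move=> k s t; rewrite /contract_outer !linearP. Qed.
HB.instance Definition _ := GRing.isLinear.Build K (A ⊗ (A ⊗ A)) (A ⊗ A) *:%R
  contract_outer contract_outer_linear.

Lemma contract_outerE x (t : A ⊗ A) : contract_outer (x ⊗ₜ t) = ract t x.
Proof.
elim/tensorP: t => [|s t hs ht|u v].
- by rewrite /ract linear0r !linear0.
- by rewrite /ract in hs ht *; rewrite linearDr !linearD /= hs ht.
- by rewrite /contract_outer tensor_flipE tensor_assocrE tensor_mapE /= muE ractE.
Qed.

(** For [t = u ⊗ v] the contraction of [u ⊗ (v ⊗ x)] is [v ⊗ x u], and the flip turns it into
    [x u ⊗ v]. *)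
Lemma flip_contract_outer (t : A ⊗ A) x :
  tensor_flip (contract_outer (tensor_assocr (t ⊗ₜ x))) = lact x t.
Proof.
elim/tensorP: t => [|s t hs ht|u v].
- by rewrite /lact linear0l !linear0.
- by rewrite /lact in hs ht *; rewrite linearDl !linearD /= hs ht.
- by rewrite tensor_assocrE contract_outerE ractE tensor_flipE lactE.
Qed.

(** On [x ⊗ y] this is the Leibniz rule for [d (y x)]: [(d y) x] contracts [x ⊗ d y], and [y (d x)]
    is the flipped contraction of [d x ⊗ y]. *)
Lemma derivation_mu_flip (d : {linear A -> A ⊗ A}) (t : A ⊗ A) :
  derivation d ->
  d (mu (tensor_flip t)) =
    contract_outer (tensor_map idfun d t) +
    tensor_flip (contract_outer (tensor_assocr (tensor_map d idfun t))).
Proof.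
move=> dP; elim/tensorP: t => [|s t hs ht|x y].
- by rewrite !linear0 addr0.
- by rewrite !linearD /= hs ht addrACA.
rewrite tensor_flipE muE dP !tensor_mapE /=.
by rewrite contract_outerE flip_contract_outer.
Qed.

End CyclicContraction.

Section NumberOperator.
Variables (K : comNzRingType) (A : nuAlgType K) (n : nat).
Variables (d : 'I_n -> {linear A -> A ⊗ A}) (ds : 'I_n -> {linear A ⊗ A -> A}).
Local Notation N := (number_op d ds).

Lemma cyclic_gradient_irrotational b :
  gdq_ring d -> cyclically_irrotational d (cyclic_gradient d b).
Proof.
move=> [coassoc dP] i j; rewrite !ffunE /cyclic_derivative.
rewrite !derivation_mu_flip // linearD /= tensor_flipK.
(* By coassociativity the flipped term on each side is the flip of the unflipped term with [i] and
   [j] exchanged. *)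
by rewrite -!coassoc addrC.
Qed.

Fact number_op_linear : linear N.
Proof.
move=> k a b; rewrite /number_op scaler_sumr -big_split /=.
by apply: eq_bigr => i _; rewrite !linearP.
Qed.
HB.instance Definition _ := GRing.isLinear.Build K A A *:%R N number_op_linear.

Lemma number_op_derivation a b :
  (forall i, derivation (d i)) -> (forall i, bimodule_hom (ds i)) ->
  N (nmul a b) = nmul (N a) b + nmul a (N b).
Proof.
move=> dP dsP; rewrite /number_op linear_sumlz linear_sumr -big_split /=.
apply: eq_bigr => i _; have [lP rP] := dsP i.
by rewrite dP linearD /= rP lP.
Qed.

(** Serves to recognise [N ⊗ id] in the sum over [i] produced by the divergence relation. *)
Lemma tensor_map_number_opl (t : A ⊗ A) :
  tensor_map N idfun t =
    \sum_i tensor_map (ds i) idfun (tensor_map (d i) idfun t).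
Proof.
elim/tensorP: t => [|s t hs ht|x y].
- by rewrite linear0 big1 // => i _; rewrite !linear0.
- rewrite linearD /= hs ht -big_split /=.
  by apply: eq_bigr => i _; rewrite !linearD.
- rewrite tensor_mapE /= linear_sumlz /=.
  by apply: eq_bigr => i _; rewrite !tensor_mapE.
Qed.

Lemma tensor_map_number_opr (t : A ⊗ A) :
  tensor_map idfun N t =
    \sum_i tensor_map idfun (ds i) (tensor_map idfun (d i) t).
Proof.
elim/tensorP: t => [|s t hs ht|x y].
- by rewrite linear0 big1 // => i _; rewrite !linear0.
- rewrite linearD /= hs ht -big_split /=.
  by apply: eq_bigr => i _; rewrite !linearD.
- rewrite tensor_mapE /= linear_sumr /=.
  by apply: eq_bigr => i _; rewrite !tensor_mapE.
Qed.

Lemma gradient_number_op j b : gdq_ring d -> divergence d ds ->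
  d j (N b) = tensor_map N idfun (d j b) + tensor_map idfun N (d j b) + d j b.
Proof.
move=> [coassoc _] divP; rewrite linear_sum /=.
(* Coassociativity, used once in each direction, makes [d j] act first in both terms, so that [ds i]
   directly follows [d i]. *)
under eq_bigr => i _ do rewrite divP -coassoc tensor_assocrK coassoc.
rewrite !big_split /= -tensor_map_number_opl -tensor_map_number_opr.
by rewrite (sum_delta_scale j (fun i => d i b)).
Qed.

(** On [x ⊗ y] both sides equal [N (y x)], expanded by the Leibniz rule for [N]. *)
Lemma mu_flip_number_op (t : A ⊗ A) :
  (forall i, derivation (d i)) -> (forall i, bimodule_hom (ds i)) ->
  mu (tensor_flip (tensor_map N idfun t + tensor_map idfun N t)) =
    N (mu (tensor_flip t)).
Proof.
move=> dP dsP; elim/tensorP: t => [|s t hs ht|x y].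
- by rewrite !linear0 addr0 !linear0.
- rewrite [tensor_map N _ _]linearD [tensor_map _ N _]linearD /= addrACA.
  rewrite [in LHS]linearD [LHS]linearD /= hs ht.
  rewrite [tensor_flip (s + t)]linearD [mu (_ + _)]linearD.
  by rewrite [N (_ + _)]linearD.
- rewrite !tensor_mapE linearD /= !tensor_flipE linearD /= !muE.
  by rewrite number_op_derivation // addrC.
Qed.

Lemma cyclic_derivative_number_op j b :
  gdq_ring d -> divergence d ds -> (forall i, bimodule_hom (ds i)) ->
  cyclic_derivative (d j) (N b) = number_op1 d ds (cyclic_derivative (d j) b).
Proof.
move=> gdq divP dsP; rewrite /cyclic_derivative gradient_number_op //.
by rewrite 2!linearD /= mu_flip_number_op //; case: gdq.
Qed.

End NumberOperator.

Theorem theorem4p1 (R : realType) (n : nat) (A : nuAlgType R[i])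
    (d : 'I_n -> {linear A -> A ⊗ A})
    (ds : 'I_n -> {linear A ⊗ A -> A})
    (Ds : 'I_n -> {linear A -> A}) :
  gdq_ring d ->
  divergence d ds -> (forall i, bimodule_hom (ds i)) ->
  cyclic_divergence d ds Ds ->
  injective (number_op1 d ds) ->
  (range (cyclic_div Ds) `<=` range (number_op d ds))%classic ->
  forall a : {ffun 'I_n -> A},
    [<-> exists b : A, cyclic_gradient d b = a;
         cyclically_irrotational d a;
         forall j, cyclic_derivative (d j) (cyclic_div Ds a) =
                   number_op1 d ds (a j)].
Proof.
move=> gdq divP dsP DsP injL ranDs a; tfae.
- by move=> [b <-]; exact: cyclic_gradient_irrotational.
- move=> irr j; rewrite /cyclic_div /cyclic_derivative !linear_sum /=.
  rewrite (eq_bigr (fun i => ds i (d i (a j)) + (i == j)%:R *: a i)); last first.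
    by move=> i _; rewrite irr; exact: DsP.
  by rewrite big_split /= sum_delta_scale.
- move=> gradL.
  have [b _ Nb] : range (number_op d ds) (cyclic_div Ds a).
    by apply: ranDs; exists a.
  exists b; apply/ffunP => j; rewrite ffunE; apply: injL.
  by rewrite -gradL -Nb cyclic_derivative_number_op.
Qed.
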